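(* The category ${\sf HeytFrm}^*$ is dually equivalent to the category ${\sf ES}^*$.
   Context: ${\sf HeytFrm}^*$: objects are Heyting frames (frames $L$ whose set $K(L)$ of compact elements is a Heyting subalgebra of $L$: contains $0,1$, closed under finite meets, finite joins and the frame implication); morphisms are complete lattice homomorphisms (preserving arbitrary meets and joins) that send compact elements to compact elements. ${\sf ES}^*$: objects are Esakia spaces (compact spaces with a partial order such that $x\not\le y$ implies there is a clopen upset containing $x$ but not $y$, and ${\downarrow}U$ is clopen for each clopen $U$); morphisms are continuous order-preserving maps $f:X\to Y$ with $f^{-1}({\downarrow}\,{\sf cl}\,D)={\downarrow}\,{\sf cl}\,f^{-1}(D)$ for every downset $D$ of $Y$, ${\sf cl}$ denoting closure.
   Formalization: Heyting frames are additionally required to be coherent, i.e. every element is a join of compact elements; without this, frames such as [0,1] with a new top adjoined would be Heyting frames and the duality would fail. *)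

(* Defs.v *)
From HB Require Import structures.
From mathcomp Require Import all_boot all_order.
From mathcomp Require Import boolp classical_sets filter.
From mathcomp Require Import topology_structure compact order_topology.

Set Implicit Arguments.
Unset Strict Implicit.
Unset Printing Implicit Defensive.

Local Open Scope classical_set_scope.

Record category := Category {
  obj :> Type;
  hom : obj -> obj -> Type;
  idm : forall a, hom a a;
  comp : forall a b c, hom b c -> hom a b -> hom a c;
  comp_idl : forall a b (f : hom a b), comp (idm b) f = f;
  comp_idr : forall a b (f : hom a b), comp f (idm a) = f;
  compA : forall a b c d (h : hom c d) (g : hom b c) (f : hom a b),
    comp h (comp g f) = comp (comp h g) f }.

Arguments hom {_} a b.
Arguments idm {_} a.
Arguments comp {_ _ _ _} g f.

Definition op (C : category) : category :=
  @Category C (fun a b => hom b a) (fun a => idm a)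
    (fun a b c g f => comp f g)
    (fun a b f => comp_idr f)
    (fun a b f => comp_idl f)
    (fun a b c d h g f => esym (compA f g h)).

Definition is_iso (C : category) (a b : C) (f : hom a b) : Prop :=
  exists g : hom b a, comp g f = idm a /\ comp f g = idm b.

Record functor (C D : category) := Functor {
  fobj :> C -> D;
  fmap : forall a b : C, hom a b -> hom (fobj a) (fobj b);
  fmap_id : forall a : C, fmap (idm a) = idm (fobj a);
  fmap_comp : forall (a b c : C) (g : hom b c) (f : hom a b),
    fmap (comp g f) = comp (fmap g) (fmap f) }.

Definition functor_id (C : category) : functor C C :=
  @Functor C C (fun a => a) (fun a b f => f)
    (fun a => erefl) (fun a b c g f => erefl).

Section FunctorComp.
Variables (C D E : category) (G : functor D E) (F : functor C D).

Lemma functor_comp_id (a : C) :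
  fmap G (fmap F (idm a)) = idm (G (F a)).
Proof. by rewrite !fmap_id. Qed.

Lemma functor_comp_comp (a b c : C) (g : hom b c) (f : hom a b) :
  fmap G (fmap F (comp g f)) = comp (fmap G (fmap F g)) (fmap G (fmap F f)).
Proof. by rewrite !fmap_comp. Qed.

Definition functor_comp : functor C E :=
  @Functor C E (fun a => G (F a)) (fun a b f => fmap G (fmap F f))
    functor_comp_id functor_comp_comp.

End FunctorComp.

Definition naturally_isomorphic (C D : category) (F G : functor C D) : Prop :=
  exists eta : forall a : C, hom (F a) (G a),
    (forall (a b : C) (f : hom a b),
       comp (eta b) (fmap F f) = comp (fmap G f) (eta a)) /\
    (forall a : C, is_iso (eta a)).

Definition equivalent (C D : category) : Prop :=
  exists (F : functor C D) (G : functor D C),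
    naturally_isomorphic (functor_comp G F) (functor_id C) /\
    naturally_isomorphic (functor_comp F G) (functor_id D).

Definition dually_equivalent (C D : category) : Prop := equivalent (op C) D.

Section Frames.
Context {d : Order.disp_t}.
Implicit Type L : tbLatticeType d.

(* MathComp has no complete lattices: joins and meets of arbitrary subsets are *)
(* the elements of [supremums A] and [infimums A], unique when they exist.     *)
Definition is_frame L : Prop :=
  (forall A : set L, supremums A !=set0) /\
  (forall (x : L) (A : set L) (s : L), supremums A s ->
     supremums [set (x `&` a)%O | a in A] (x `&` s)%O).

Definition compact_elements L : set L :=
  [set k | forall (A : set L) (s : L), supremums A s -> (k <= s)%O ->
     exists2 r : seq L, (forall x, x \in r -> A x) &
       (k <= \join_(x <- r) x)%O].

Definition is_implication L (a b c : L) : Prop :=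
  supremums [set x | (a `&` x <= b)%O] c.

Definition is_heyting_subalgebra L (K : set L) : Prop :=
  [/\ K \bot%O /\ K \top%O,
      forall a b, K a -> K b -> K (a `&` b)%O,
      forall a b, K a -> K b -> K (a `|` b)%O &
      forall a b c, K a -> K b -> is_implication a b c -> K c].

Definition join_generates L (K : set L) : Prop :=
  forall x : L, supremums [set k | K k /\ (k <= x)%O] x.

(* Heyting frames are coherent frames, hence the join-generation clause:       *)
(* without it, [0, 1] with a new top adjoined, whose only compact elements are *)
(* bottom and top, would be a Heyting frame, and the duality would fail.       *)
Definition is_heyting_frame L : Prop :=
  [/\ is_frame L,
      join_generates (@compact_elements L) &
      is_heyting_subalgebra (@compact_elements L)].

End Frames.

Arguments compact_elements {d} L.

Definition preserves_joins d d' (L : tbLatticeType d) (M : tbLatticeType d')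
    (f : L -> M) : Prop :=
  forall (A : set L) (s : L), supremums A s -> supremums (f @` A) (f s).

Definition preserves_meets d d' (L : tbLatticeType d) (M : tbLatticeType d')
    (f : L -> M) : Prop :=
  forall (A : set L) (s : L), infimums A s -> infimums (f @` A) (f s).

Definition is_heytfrm_star_morphism d d' (L : tbLatticeType d)
    (M : tbLatticeType d') (f : L -> M) : Prop :=
  [/\ preserves_joins f,
      preserves_meets f &
      forall k, compact_elements L k -> compact_elements M (f k)].

Record heyting_frame := HeytingFrame {
  hf_disp : Order.disp_t;
  hf_sort :> tbLatticeType hf_disp;
  hf_axiom : is_heyting_frame hf_sort }.

Definition heytfrm_hom (L M : heyting_frame) : Type :=
  {f : L -> M | is_heytfrm_star_morphism f}.

Lemma heytfrm_id_subproof (L : heyting_frame) :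
  is_heytfrm_star_morphism (fun x : L => x).
Proof. by split=> // A s; rewrite image_id. Qed.

Lemma heytfrm_comp_subproof (L M N : heyting_frame)
    (g : heytfrm_hom M N) (f : heytfrm_hom L M) :
  is_heytfrm_star_morphism (fun x => sval g (sval f x)).
Proof.
case: g f => [g [gj gm gk]] [f [fj fm fk]] /=; split=> [A s As|A s As|k Kk].
- by have := gj _ _ (fj _ _ As); rewrite image_comp.
- by have := gm _ _ (fm _ _ As); rewrite image_comp.
- exact: gk (fk _ Kk).
Qed.

Definition heytfrm_id (L : heyting_frame) : heytfrm_hom L L :=
  exist _ _ (heytfrm_id_subproof L).

Definition heytfrm_comp (L M N : heyting_frame)
    (g : heytfrm_hom M N) (f : heytfrm_hom L M) : heytfrm_hom L N :=
  exist _ _ (heytfrm_comp_subproof g f).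

Definition HeytFrm_star : category.
Proof.
refine (@Category heyting_frame heytfrm_hom heytfrm_id heytfrm_comp _ _ _).
- by move=> L M [f fP]; exact: eq_exist.
- by move=> L M [f fP]; exact: eq_exist.
- by move=> L M N P [h hP] [g gP] [f fP]; exact: eq_exist.
Defined.

Section OrderedSpaces.
Context {d : Order.disp_t}.
Implicit Type X : POrderedTopological.type d.

Definition upset X (U : set X) : Prop :=
  forall x y : X, (x <= y)%O -> U x -> U y.

Definition downset X (D : set X) : Prop :=
  forall x y : X, (x <= y)%O -> D y -> D x.

Definition down X (A : set X) : set X :=
  [set x | exists2 y, A y & (x <= y)%O].

Definition is_esakia X : Prop :=
  [/\ compact [set: X],
      forall x y : X, ~ (x <= y)%O ->
        exists U : set X, [/\ clopen U, upset U, U x & ~ U y] &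
      forall U : set X, clopen U -> clopen (down U)].

End OrderedSpaces.

Definition is_es_star_morphism d d' (X : POrderedTopological.type d)
    (Y : POrderedTopological.type d') (f : X -> Y) : Prop :=
  [/\ continuous f,
      {homo f : x y / (x <= y)%O} &
      forall D : set Y, downset D ->
        f @^-1` (down (closure D)) = down (closure (f @^-1` D))].

Record esakia_space := EsakiaSpace {
  es_disp : Order.disp_t;
  es_sort :> POrderedTopological.type es_disp;
  es_axiom : is_esakia es_sort }.

Definition es_hom (X Y : esakia_space) : Type :=
  {f : X -> Y | is_es_star_morphism f}.

Lemma es_id_subproof (X : esakia_space) :
  is_es_star_morphism (fun x : X => x).
Proof. by split=> // x; exact: id. Qed.

Lemma es_comp_subproof (X Y Z : esakia_space)
    (g : es_hom Y Z) (f : es_hom X Y) :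
  is_es_star_morphism (fun x => sval g (sval f x)).
Proof.
case: g f => [g [gc gh gd]] [f [fc fh fd]] /=; split.
- by move=> x; apply: continuous_comp; [exact: fc|exact: gc].
- by move=> x y xy; exact: gh (fh _ _ xy).
- move=> D Ddown.
  have gD : downset (g @^-1` D) by move=> x y xy; exact: Ddown (gh _ _ xy).
  by rewrite -[LHS]/(f @^-1` (g @^-1` down (closure D))) gd// fd.
Qed.

Definition es_id (X : esakia_space) : es_hom X X :=
  exist _ _ (es_id_subproof X).

Definition es_comp (X Y Z : esakia_space)
    (g : es_hom Y Z) (f : es_hom X Y) : es_hom X Z :=
  exist _ _ (es_comp_subproof g f).

Definition ES_star : category.
Proof.
refine (@Category esakia_space es_hom es_id es_comp _ _ _).
- by move=> X Y [f fP]; exact: eq_exist.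
- by move=> X Y [f fP]; exact: eq_exist.
- by move=> X Y Z W [h hP] [g gP] [f fP]; exact: eq_exist.
Defined.

(* Main.v *)
(* A Heyting frame [L] is sent to the space of its meet-prime elements [p], with
the order of [L] reversed and the patch topology, whose basic open sets are
[{p | ~ k <= p /\ l <= p}] for [k] and [l] compact; a morphism is sent to its
right adjoint. An Esakia space is sent to the frame of its open upsets, whose
compact elements are the clopen ones; a morphism is sent to inverse image. The
unit maps [a] to [{p | ~ a <= p}] and the counit maps [x] to the complement of
the principal downset of [x].

The condition on downsets in the definition of the morphisms of Esakia spaces
expresses preservation of arbitrary meets: the meet of a family of open upsets is
the complement of [down (closure D)], where [D] is the union of the complements
of its members, and dually [down (closure D)] in the space of [L] consists of the
meet-primes above the infimum of [D]. *)

From HB Require Import structures.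
From mathcomp Require Import all_boot all_order.
From mathcomp Require Import boolp classical_sets filter.
From mathcomp Require Import topology_structure separation_axioms compact.
From mathcomp Require Import subspace_topology order_topology.
Require Import Defs.

Set Implicit Arguments.
Unset Strict Implicit.
Unset Printing Implicit Defensive.

Import Order.TTheory.

Local Open Scope classical_set_scope.

(** If every member of [B] met [C], the sets [C]&[U] would generate a proper filter, and a cluster
    point of it would lie in [C] and in every closed [U] of [B]. Stability of [B] under intersection
    replaces the passage to finite subfamilies. *)
Lemma compact_closed_avoid (T : topologicalType) (C : set T)
    (B : set (set T)) :
  compact [set: T] -> closed C -> B setT ->
  (forall U V, B U -> B V -> B (U `&` V)) -> (forall U, B U -> closed U) ->
  (forall q, C q -> exists2 U, B U & ~ U q) ->
  exists2 U, B U & forall q, C q -> ~ U q.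
Proof.
move=> cT cC BT BI Bcl BC; apply: contrapT => nex.
pose F := filter_from B (fun U => C `&` U).
have PF : ProperFilter F.
  apply: filter_from_proper.
    apply: filter_from_filter; first by exists setT.
    move=> U V BU BV; exists (U `&` V); first exact: BI.
    by move=> x [Cx [Ux Vx]].
  move=> U BU; apply: contrapT => CU0; apply: nex; exists U => // q Cq Uq.
  by apply: CU0; exists q.
have [|p [_ clp]] := cT F PF.
  by exists setT.
have clF U : B U -> (C `&` U) p.
  move=> BU; have : closed (C `&` U) by apply: closedI => //; exact: Bcl.
  apply; move: clp; rewrite clusterE => /(_ (C `&` U)); apply.
  by exists U.
have [Cp _] := clF _ BT.
have [U BU nUp] := BC _ Cp.
by have [_ /nUp] := clF _ BU.
Qed.

(** * Joins, compact elements and meet-primes of a Heyting frame *)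

Section HeytingFrame.
Variable L : heyting_frame.
Local Open Scope order_scope.
Local Notation K := (@compact_elements _ L).
Implicit Types (x y z k l : L) (A : set L).

(** The default [\bot] is never returned, since a frame has all suprema. *)
Definition hf_sup A : L := xget \bot (supremums A).
Definition hf_inf A : L := hf_sup (lbound A).

Lemma hf_supP A : supremums A (hf_sup A).
Proof.
have [[/(_ A) [s As] _] _ _] := hf_axiom L.
by rewrite /hf_sup; case: xgetP => [_ -> //|/(_ s)].
Qed.

Lemma le_hf_sup A x : A x -> x <= hf_sup A.
Proof. by have [+ _] := hf_supP A; apply. Qed.

Lemma hf_sup_le A y : (forall x, A x -> x <= y) -> hf_sup A <= y.
Proof. by have [_] := hf_supP A; apply. Qed.

Lemma hf_inf_le A x : A x -> hf_inf A <= x.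
Proof. by move=> Ax; apply: hf_sup_le => y; apply. Qed.

Lemma le_hf_inf A y : (forall x, A x -> y <= x) -> y <= hf_inf A.
Proof. by move=> yA; apply: le_hf_sup. Qed.

Lemma hf_infP A : infimums A (hf_inf A).
Proof. by split=> [x|y]; [exact: hf_inf_le|exact: le_hf_inf]. Qed.

Lemma hf_meet_sup_le x A y :
  (forall a, A a -> x `&` a <= y) -> x `&` hf_sup A <= y.
Proof.
move=> Ay; have [[_ dist] _ _] := hf_axiom L.
by have [_] := dist x A _ (hf_supP A); apply=> _ [a Aa <-]; exact: Ay.
Qed.

Lemma hf_meet_join_le x y z u :
  x `&` y <= u -> x `&` z <= u -> x `&` (y `|` z) <= u.
Proof.
move=> xy xz; apply: (@le_trans _ _ (x `&` hf_sup [set y; z])).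
  by apply: leI2 => //; rewrite leUx !le_hf_sup//; [right|left].
by apply: hf_meet_sup_le => _ [] ->.
Qed.

Lemma hf_le_compact x y : (forall k, K k -> k <= x -> k <= y) -> x <= y.
Proof.
have [_ gen _] := hf_axiom L => ky; have [_] := gen x; apply=> k [Kk kx].
exact: ky.
Qed.

Lemma compact_not_le x y : ~ x <= y -> exists k, [/\ K k, k <= x & ~ k <= y].
Proof.
move=> nxy; apply: contrapT => nex; apply: nxy; apply: hf_le_compact => k Kk kx.
by apply: contrapT => nky; apply: nex; exists k.
Qed.

Lemma compact_bot : K \bot.
Proof. by have [_ _ [[]]] := hf_axiom L. Qed.

Lemma compact_top : K \top.
Proof. by have [_ _ [[]]] := hf_axiom L. Qed.

Lemma compact_meet k l : K k -> K l -> K (k `&` l).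
Proof. by have [_ _ [_ + _ _]] := hf_axiom L; apply. Qed.

Lemma compact_join k l : K k -> K l -> K (k `|` l).
Proof. by have [_ _ [_ _ + _]] := hf_axiom L; apply. Qed.

Lemma compact_implication k l : K k -> K l ->
  exists2 c, K c & forall x, (x <= c) = (k `&` x <= l).
Proof.
move=> Kk Kl; have [_ _ [_ _ _ imp]] := hf_axiom L.
exists (hf_sup [set x | k `&` x <= l]); first exact/(imp k l)/hf_supP.
move=> x; apply/idP/idP => [xc|kx]; last exact: le_hf_sup.
apply: le_trans (leI2 (lexx _) xc) _; exact: hf_meet_sup_le.
Qed.

(** The join of finitely many members of a chain lies below one of them; [a] serves for the empty
    join. *)
Lemma compact_le_chain k A (a : L) : K k -> A a ->
  total_on A (fun x y => x <= y) -> k <= hf_sup A -> exists2 x, A x & k <= x.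
Proof.
move=> Kk Aa totA kA; have [r rA kr] := Kk _ _ (hf_supP A) kA.
suff [x Ax rx] : exists2 x, A x & \join_(y <- r) y <= x.
  by exists x => //; exact: le_trans rx.
elim: r rA {kr} => [|y r IH] rA; first by exists a; rewrite // big_nil le0x.
have [z zr|x Ax rx] := IH; first by apply: rA; rewrite inE zr orbT.
have Ay : A y by apply: rA; rewrite mem_head.
by rewrite big_cons; have [xy|yx] := totA _ _ Ax Ay;
  [exists y|exists x] => //; rewrite leUx ?lexx ?yx ?rx// (le_trans rx).
Qed.

Definition meet_prime (p : L) : Prop :=
  ~ \top <= p /\ forall x y, x `&` y <= p -> x <= p \/ y <= p.

(** Zorn's lemma gives a maximal [p] above [b] that lies above no member of [S]; compactness of
    these members lets joins of chains keep the property. If [x] and [y] are not below [p],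
    maximality puts some [s] and [t] of [S] below the joins of [p] with [x] and with [y]; by
    distributivity the meet of [s] and [t], again in [S], lies below the join of [p] with [x]&[y],
    so the latter is not below [p]. *)
Lemma meet_prime_exists (S : set L) (s0 b : L) : S s0 ->
  (forall s, S s -> K s) -> (forall s t, S s -> S t -> S (s `&` t)) ->
  (forall s, S s -> ~ s <= b) ->
  exists p, [/\ meet_prime p, b <= p & forall s, S s -> ~ s <= p].
Proof.
move=> Ss0 SK SI Sb.
pose avoid := {x : L | b <= x /\ forall s, S s -> ~ s <= x}.
pose b0 : avoid := exist _ b (conj (lexx b) Sb).
have [||C totC|[p pP] pmax] :=
    @ZL_preorder avoid b0 (fun u v => sval u <= sval v).
- by move=> u; exact: lexx.
- by move=> v u w; exact: le_trans.
(* The empty chain is bounded by [b] itself, since its join [\bot] need not lie above [b]. *)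
- have [[c Cc]|C0] := pselect (C !=set0); last first.
    by exists b0 => u Cu; case: C0; exists u.
  pose A := [set sval u | u in C].
  have Ac : A (sval c) by exists c.
  have totA : total_on A (fun x y => x <= y).
    by move=> _ _ [u Cu <-] [v Cv <-]; exact: totC.
  have CP : b <= hf_sup A /\ forall s, S s -> ~ s <= hf_sup A.
    split; first by apply: le_trans (le_hf_sup Ac); have [] := svalP c.
    move=> s Ss /(compact_le_chain (SK _ Ss) Ac totA) [_ [u _ <-]].
    by have [_] := svalP u; apply.
  by exists (exist _ (hf_sup A) CP) => u Cu; apply: le_hf_sup; exists u.
have [bp Sp] := pP.
exists p; split=> //; split.
  by move=> /(le_trans (lex1 s0)); exact: Sp.
have meets x : ~ x <= p -> exists2 s, S s & s <= p `|` x.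
  move=> nxp; apply: contrapT => nex; apply: nxp.
  have PP : b <= p `|` x /\ forall s, S s -> ~ s <= p `|` x.
    split; first exact: le_trans bp (leUl _ _).
    by move=> s Ss sp; apply: nex; exists s.
  have := pmax (exist _ (p `|` x) PP) (leUl _ _).
  by apply: le_trans; exact: leUr.
move=> x y xyp; apply: contrapT => /not_orP[/meets[s Ss sx] /meets[t St ty]].
apply: (Sp _ (SI _ _ Ss St)); apply: le_trans (leI2 sx ty) _.
apply: hf_meet_join_le; first exact: leIr.
rewrite meetC; apply: hf_meet_join_le; first exact: leIr.
by rewrite meetC.
Qed.

Lemma meet_prime_not_le x y : ~ x <= y ->
  exists p, [/\ meet_prime p, y <= p & ~ x <= p].
Proof.
move=> /compact_not_le[k [Kk kx nky]].
have [||||p [pp yp kp]] := @meet_prime_exists [set k] k y.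
- by [].
- by move=> _ ->.
- by move=> _ _ -> ->; rewrite meetxx.
- by move=> _ ->.
by exists p; split=> // /(le_trans kx); exact: kp.
Qed.

End HeytingFrame.

(** * The spectrum: meet-primes with the reversed order and the patch topology *)

Record spec (L : heyting_frame) : Type := Spec {
  spec_val :> L;
  spec_prime : meet_prime spec_val }.

HB.instance Definition _ (L : heyting_frame) := gen_eqMixin (spec L).
HB.instance Definition _ (L : heyting_frame) := gen_choiceMixin (spec L).

Section Spectrum.
Variable L : heyting_frame.
Local Notation K := (@compact_elements _ L).
Implicit Types (p q : spec L) (a k l : L).

Lemma spec_val_inj : injective (@spec_val L).
Proof.
case=> [p pP] [q qP] /= pq; move: pP qP; rewrite pq => pP qP.
by congr Spec; exact: Prop_irrelevance.
Qed.

Lemma spec_eq p q :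
  (forall x, (x <= spec_val p)%O = (x <= spec_val q)%O) -> p = q.
Proof.
move=> pq; apply/spec_val_inj/le_anti.
by rewrite -(pq (spec_val p)) (pq (spec_val q)) !lexx.
Qed.

Lemma spec_top p : ~ (\top <= spec_val p)%O.
Proof. by have [] := spec_prime p. Qed.

Lemma spec_meet p a b :
  (a `&` b <= spec_val p)%O -> (a <= spec_val p)%O \/ (b <= spec_val p)%O.
Proof. by have [_] := spec_prime p; apply. Qed.

(* The order of [L] is reversed so that [spec_open a] is an upset. *)
Definition spec_le p q : bool := (spec_val q <= spec_val p)%O.

Lemma spec_le_refl : reflexive spec_le.
Proof. by move=> p; exact: lexx. Qed.

Lemma spec_le_anti : antisymmetric spec_le.
Proof. by move=> p q /le_anti/esym/spec_val_inj. Qed.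

Lemma spec_le_trans : transitive spec_le.
Proof. by move=> q p r qp rq; exact: le_trans rq qp. Qed.

Definition spec_open a : set (spec L) := [set p | ~ (a <= spec_val p)%O].

Definition patch_basic k l : set (spec L) :=
  [set p | ~ (k <= spec_val p)%O /\ (l <= spec_val p)%O].

Definition patch_open (U : set (spec L)) : Prop :=
  forall p, U p -> exists k l,
    [/\ K k, K l, patch_basic k l p & patch_basic k l `<=` U].

Lemma patch_openT : patch_open setT.
Proof.
move=> p _; exists \top%O, \bot%O; split=> //.
- exact: compact_top.
- exact: compact_bot.
- by split; [exact: spec_top|exact: le0x].
Qed.

(** Two basic sets intersect in a basic one: by primality, a point above neither [k] nor [k'] is not
    above their meet, and a point above [l] and [l'] is above their join. *)
Lemma patch_openI : setI_closed patch_open.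
Proof.
move=> U V Uo Vo p [/Uo[k [l [Kk Kl [kp lp] klU]]]].
move=> /Vo[k' [l' [Kk' Kl' [kp' lp'] klV]]].
exists (k `&` k')%O, (l `|` l')%O; split.
- exact: compact_meet.
- exact: compact_join.
- by split; [move=> /spec_meet[]|rewrite leUx lp].
- move=> q [kq]; rewrite leUx => /andP[lq lq'].
  split; [apply: klU|apply: klV]; split=> //.
    by move=> k1; apply: kq; rewrite (le_trans (leIl _ _)).
  by move=> k1; apply: kq; rewrite (le_trans (leIr _ _)).
Qed.

Lemma patch_open_bigcup (I : Type) (f : I -> set (spec L)) :
  (forall i, patch_open (f i)) -> patch_open (\bigcup_i f i).
Proof.
move=> fo p [i _ /fo[k [l [Kk Kl klp klf]]]]; exists k, l; split=> //.
by move=> q /klf; exists i.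
Qed.

End Spectrum.

HB.instance Definition _ (L : heyting_frame) :=
  Order.Le_isPOrder.Build (Order.Disp tt tt) (spec L)
    (@spec_le_refl L) (@spec_le_anti L) (@spec_le_trans L).

HB.instance Definition _ (L : heyting_frame) :=
  isOpenTopological.Build (spec L)
    (@patch_openT L) (@patch_openI L) (@patch_open_bigcup L).

(** * The spectrum is an Esakia space *)

Section SpectrumTopology.
Variable L : heyting_frame.
Local Notation K := (@compact_elements _ L).
Implicit Types (p q : spec L) (a k l : L).

Lemma spec_leE p q : (p <= q)%O = (spec_val q <= spec_val p)%O.
Proof. by []. Qed.

Lemma spec_openE (U : set (spec L)) : open U = patch_open U.
Proof. by []. Qed.

Lemma open_patch_basic k l : K k -> K l -> open (patch_basic (L := L) k l).
Proof. by move=> Kk Kl; rewrite spec_openE => p klp; exists k, l; split. Qed.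

Lemma spec_open_open a : open (spec_open a).
Proof.
rewrite spec_openE => p /compact_not_le[k [Kk ka kp]].
exists k, \bot%O; split=> //; first exact: compact_bot.
by move=> q [kq _] aq; exact: kq (le_trans ka aq).
Qed.

Lemma spec_open_closed k : K k -> closed (spec_open k).
Proof.
move=> Kk; rewrite -openC spec_openE => p /contrapT kp.
exists \top%O, k; split=> //; first exact: compact_top.
  by split=> //; exact: spec_top.
by move=> q [_ kq]; apply.
Qed.

Lemma spec_open_upset a : upset (spec_open a).
Proof. by move=> p q qp ap aq; exact: ap (le_trans aq qp). Qed.

Lemma spec_le_sub (x y : L) : spec_open x `<=` spec_open y -> (x <= y)%O.
Proof.
move=> xy; apply: contrapT => /meet_prime_not_le[p [pp yp xp]].
exact: (xy (Spec pp)).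
Qed.

Lemma setC_spec_open a : ~` spec_open a = [set p | (a <= spec_val p)%O].
Proof. by apply/seteqP; split=> p /= => [/contrapT|ap]. Qed.

(** An ultrafilter [F] converges to the join of [N], the compact [k] such that [F]-almost all points
    lie above [k]. [N] is closed under finite joins, so a compact element below its join already
    belongs to [N]; primality of the join then follows from that of the points and from [F] deciding
    each [spec_open k]. *)
Lemma spec_compact : compact [set: spec L].
Proof.
rewrite compact_ultra => F FU _.
pose N := [set k | K k /\ F (~` spec_open k)].
have NU k l : N k -> N l -> N (k `|` l)%O.
  rewrite /N /= !setC_spec_open => -[Kk Fk] [Kl Fl].
  split; first exact: compact_join.
  by apply: filterS (filterI Fk Fl) => q [/= kq lq]; rewrite leUx kq.
have N0 : N \bot%O.
  rewrite /N /= setC_spec_open; split; first exact: compact_bot.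
  by apply: filterS (@filterT _ F _) => q _ /=; exact: le0x.
have NP k : K k -> (k <= hf_sup N)%O -> N k.
  move=> Kk kN; split=> //; have [r rN kr] := Kk _ _ (hf_supP N) kN.
  have [_ ] : N (\join_(x <- r) x)%O.
    by rewrite big_seq; elim/big_ind: _.
  by rewrite !setC_spec_open; apply: filterS => q; exact: le_trans kr.
have pP : meet_prime (hf_sup N).
  split=> [/(NP _ (@compact_top L))[_ /filter_ex[q]]|x y xyN].
    by rewrite setC_spec_open; exact: spec_top.
  apply: contrapT => /not_orP[].
  move=> /compact_not_le[k [Kk kx nk]] /compact_not_le[l [Kl ly nl]].
  have [||_ Fkl] := NP (k `&` l)%O; first exact: compact_meet.
    exact: le_trans (leI2 kx ly) xyN.
  have [Fk|Fk] := in_ultra_setVsetC (spec_open k) FU; last first.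
    by apply: nk; exact: le_hf_sup.
  apply: nl; apply: le_hf_sup; split=> //.
  move: Fkl; rewrite !setC_spec_open => Fkl.
  by apply: filterS (filterI Fk Fkl) => q [kq /= /spec_meet[/kq|]].
exists (Spec pP); split=> // U.
rewrite nbhsE => -[V [+ Vp] VU]; rewrite spec_openE => /(_ _ Vp).
move=> [k [l [Kk Kl [/= kN lN] klV]]].
apply: filterS VU _; apply: filterS klV _; apply: filterI.
  have [Fk|] := in_ultra_setVsetC (spec_open k) FU; first by [].
  by move=> Fk; case: kN; exact: le_hf_sup.
by have [_] := NP _ Kl lN; apply: filterS => q /contrapT.
Qed.

(** Each [q] in [C] is excluded by some [spec_open k] containing [p]. By primality these sets are
    stable under intersection, so compactness yields one [k] for all of [C]. *)
Lemma spec_separation (C : set (spec L)) p : closed C ->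
  (forall q, C q -> ~ (p <= q)%O) ->
  exists k, [/\ K k, spec_open k p & forall q, C q -> ~ spec_open k q].
Proof.
move=> Ccl Cp.
pose B := [set U | exists k, [/\ K k, U = spec_open k & U p]].
have [||_ [k [Kk -> _]]|q Cq|_ [k [Kk -> kp]] kC] :=
  compact_closed_avoid (B := B) spec_compact Ccl; last by exists k.
- exists \top%O; split=> //; first exact: compact_top.
  by apply/seteqP; split=> q // _; exact: spec_top.
- move=> _ _ [k [Kk -> kp]] [l [Kl -> lp]].
  exists (k `&` l)%O; split=> //; first exact: compact_meet.
  apply/seteqP; split=> q /=; first by move=> [kq lq] /spec_meet[].
  by move=> klq; split=> ?; apply: klq;
    [rewrite (le_trans (leIl _ _))|rewrite (le_trans (leIr _ _))].
- exact: spec_open_closed.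
- have /compact_not_le[k [Kk kq kp]] := Cp _ Cq.
  by exists (spec_open k); [exists k|apply].
Qed.

(** The element [c] is the implication from [k] to [l], compact because the compact elements form a
    Heyting subalgebra. *)
Lemma down_patch_basic k l : K k -> K l ->
  exists2 c, K c & down (patch_basic k l) = ~` spec_open c :> set (spec L).
Proof.
move=> Kk Kl; have [c Kc impc] := compact_implication Kk Kl.
exists c => //; rewrite setC_spec_open; apply/seteqP; split=> p /=.
  move=> [q [kq lq]]; rewrite spec_leE => qp; apply: le_trans qp.
  have kcq : (k `&` c <= spec_val q)%O by apply: le_trans lq; rewrite -impc.
  by case/spec_meet: kcq => // /kq.
move=> cp.
(* A meet-prime [r] above [l] but above no member of [S] is the required point: [m = \top] shows
   that [k] is not below [r], and the other [m] force [r] below [p] in [L]. No member of [S] is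
   below [l], since that would give [m <= c <= p]. *)
pose S := [set s | exists m, [/\ K m, spec_open m p & s = k `&` m]%O].
have [||_ _ [m [Km mp ->]] [n [Kn np ->]]|_ [m [Km mp ->]]|r [Pr lr Sr]] :=
    @meet_prime_exists L S (k `&` \top)%O l.
- by exists \top%O; split=> //; [exact: compact_top|exact: spec_top].
- by move=> _ [m [Km _ ->]]; exact: compact_meet.
- exists (m `&` n)%O; split; [exact: compact_meet|by move=> /spec_meet[]|].
  by rewrite meetACA meetxx.
- by rewrite -impc => mc; apply: mp; exact: le_trans mc cp.
exists (Spec Pr).
  split=> //= kq; apply: (Sr (k `&` \top)%O); last by rewrite meetx1.
  by exists \top%O; split=> //; [exact: compact_top|exact: spec_top].
rewrite spec_leE /=; apply: contrapT => /compact_not_le[m [Km mq mp]].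
by apply: (Sr (k `&` m)%O); [exists m|rewrite (le_trans (leIr _ _))].
Qed.

Lemma downU d (X : POrderedTopological.type d) (A B : set X) :
  down (A `|` B) = down A `|` down B.
Proof.
apply/seteqP; split=> x; first by move=> [y [Ay|By] xy]; [left|right]; exists y.
by move=> [[y Ay xy]|[y By xy]]; exists y => //; [left|right].
Qed.

(** A clopen set is compact, hence a finite union of basic sets, and [down] commutes with unions.
    The family [B] consists of complements, so that a member missing [U] is exactly the complement
    of [U]. *)
Lemma down_clopen_spec (U : set (spec L)) : clopen U -> clopen (down U).
Proof.
move=> [Uo Uc].
pose B := [set V : set (spec L) |
  [/\ clopen V, ~` V `<=` U & clopen (down (~` V))]].
have [||V [[_ Vc] _ _]|p Up|V [_ VU dV] UV] :=
  compact_closed_avoid (B := B) spec_compact Uc.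
- split; [exact: clopenT|by rewrite setCT|rewrite setCT].
  rewrite (_ : down _ = set0); first exact: clopen0.
  by apply/seteqP; split=> x // [].
- move=> V W [Vc VU dV] [Wc WU dW]; split; first exact: clopenI.
    by rewrite setCI => x [/VU|/WU].
  by rewrite setCI downU; exact: clopenU.
- by [].
- have [k [l [Kk Kl klp klU]]] := Uo p Up.
  exists (~` patch_basic k l); last by apply.
  split; [|by rewrite setCK|].
    apply: (clopenC set0); split; first exact: open_patch_basic.
    rewrite (_ : patch_basic k l = spec_open k `&` ~` spec_open l).
      apply: closedI; first exact: spec_open_closed.
      by rewrite closedC; exact: spec_open_open.
    by rewrite setC_spec_open.
  rewrite setCK; have [c Kc ->] := down_patch_basic Kk Kl.
  by apply: (clopenC set0); split;
    [exact: spec_open_open|exact: spec_open_closed].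
by rewrite (_ : U = ~` V)//; apply/seteqP; split.
Qed.

Lemma spec_is_esakia : is_esakia (spec L).
Proof.
split; [exact: spec_compact| |exact: down_clopen_spec].
move=> p q; rewrite spec_leE => /compact_not_le[k [Kk kq kp]].
exists (spec_open k); split=> //.
- by split; [exact: spec_open_open|exact: spec_open_closed].
- exact: spec_open_upset.
Qed.

(** The right-hand side is a closed downset containing [D]. Conversely, a point outside
    [down (closure D)] is separated from it by a compact [k] lying below every point of [D], hence
    below the infimum. *)
Lemma down_closure_spec (D : set (spec L)) :
  down (closure D) = [set p | hf_inf [set spec_val q | q in D] <= spec_val p]%O.
Proof.
set m := hf_inf _; rewrite -setC_spec_open; apply/seteqP; split=> p.
  move=> [q clq]; rewrite spec_leE => qp; rewrite setC_spec_open /=.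
  apply: le_trans qp; suff : closure D `<=` ~` spec_open m.
    by rewrite setC_spec_open; apply.
  rewrite [X in _ `<=` X](iffLR (closure_id _)); last first.
    by rewrite closedC; exact: spec_open_open.
  apply: closureS => r Dr; rewrite setC_spec_open.
  by apply: hf_inf_le; exists r.
move=> mp; apply: contrapT => ndp.
have [||k [Kk kp kD]] := @spec_separation (closure D) p.
- exact: closed_closure.
- by move=> q Dq pq; apply: ndp; exists q.
apply: mp => mp; apply: kp; apply: le_trans mp; apply: le_hf_inf.
by move=> _ [q Dq <-]; apply: contrapT; exact/kD/subset_closure.
Qed.

(** Separating a point of [U] from the complement of [U] gives a compact [k] with [spec_open k]
    inside [U]; [a] is the join of all such [k]. *)
Lemma open_upset_spec (U : set (spec L)) :
  open U -> upset U -> exists a, U = spec_open a.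
Proof.
move=> Uo Uup; pose A := [set k | K k /\ spec_open k `<=` U].
exists (hf_sup A); apply/seteqP; split=> p.
  move=> Up; have [||k [Kk kp kU]] := @spec_separation (~` U) p.
  - exact: open_closedC.
  - by move=> q nUq pq; exact: nUq (Uup _ _ pq Up).
  move=> Ap; apply: kp; apply: le_trans Ap; apply: le_hf_sup; split=> // q kq.
  by apply: contrapT => /kU.
move=> Ap; apply: contrapT => nUp; apply: Ap; apply: hf_sup_le => k [Kk kU].
by apply: contrapT => /kU.
Qed.

End SpectrumTopology.

Definition spec_space (L : heyting_frame) : esakia_space :=
  EsakiaSpace (@spec_is_esakia L).

(** * Right adjoints as maps of spectra *)

Section SpectrumMap.
Variables (L M : heyting_frame) (f : heytfrm_hom L M).
Local Open Scope order_scope.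
Implicit Types (p q : spec M) (x y : L).

Let f_joins : preserves_joins (sval f). Proof. by have [] := svalP f. Qed.
Let f_meets : preserves_meets (sval f). Proof. by have [] := svalP f. Qed.

Definition right_adjoint (z : M) : L := hf_sup [set x | sval f x <= z].

Lemma heytfrm_hom_homo x y : x <= y -> sval f x <= sval f y.
Proof.
move=> xy; have [|+ _] := f_joins (A := [set x; y]) (s := y).
  by split=> [_ [] ->|z] //; apply; right.
by apply; exists x => //; left.
Qed.

Lemma le_right_adjoint x (z : M) : (x <= right_adjoint z) = (sval f x <= z).
Proof.
apply/idP/idP=> [|fxz]; last exact: le_hf_sup.
move=> /heytfrm_hom_homo fx; apply: le_trans fx _.
by have [_] := f_joins (hf_supP [set x | sval f x <= z]); apply=> _ [y yz <-].
Qed.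

(** Through the adjunction, the two clauses of primality follow from preservation of the empty meet
    and of binary meets. *)
Lemma meet_prime_right_adjoint p : meet_prime (right_adjoint (spec_val p)).
Proof.
split=> [|x y]; rewrite !le_right_adjoint.
  move=> fp; apply: (@spec_top M p); apply: le_trans fp.
  have [|_] := f_meets (A := set0) (s := \top).
    by split=> // z _; exact: lex1.
  by apply=> z [].
move=> fxy; apply: spec_meet; apply: le_trans fxy.
have [|_] := f_meets (A := [set x; y]) (s := x `&` y).
  split=> [_ [] ->|z zxy]; [exact: leIl|exact: leIr|].
  by rewrite lexI !zxy//; [right|left].
by apply=> _ [_ [] -> <-]; [exact: leIl|exact: leIr].
Qed.

Definition spec_map p : spec L := Spec (meet_prime_right_adjoint p).

Lemma le_spec_map x p : (x <= spec_val (spec_map p)) = (sval f x <= spec_val p).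
Proof. exact: le_right_adjoint. Qed.

Lemma spec_map_preimage x :
  spec_map @^-1` spec_open x = spec_open (sval f x).
Proof. by apply/seteqP; split=> p; rewrite /spec_open /= le_right_adjoint. Qed.

Lemma spec_map_es_star_morphism : is_es_star_morphism spec_map.
Proof.
have [_ _ fK] := svalP f; split.
- apply/continuousP => U; rewrite !spec_openE => Uo p Up.
  have [k [l [Kk Kl [kp lp] klU]]] := Uo _ Up.
  exists (sval f k), (sval f l); split; [exact: fK|exact: fK| |].
    by split; rewrite -le_spec_map.
  by move=> q [kq lq]; apply: klU; split; rewrite le_spec_map.
- move=> p q; rewrite !spec_leE le_spec_map.
  by apply: le_trans; rewrite -le_spec_map.
(* It remains to compare [f] of the infimum of [D] with the infimum of the preimage of [D]. One
   inequality is monotonicity; for the other, a meet-prime [r] above [f q] with [q] in [D] has its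
   image below [q] in the spectrum, so [r] lies in the preimage because [D] is a downset. *)
- move=> D Ddown; rewrite !down_closure_spec.
  apply/seteqP; split=> p; rewrite /= le_spec_map => Dp; apply: le_trans Dp.
    have [_] := f_meets (hf_infP [set spec_val q | q in D]).
    apply=> _ [_ [q Dq <-] <-]; apply: contrapT => /meet_prime_not_le.
    move=> [r [rP fqr]]; apply; pose r' := Spec rP.
    apply: hf_inf_le; exists r' => //; apply: Ddown Dq.
    by rewrite spec_leE le_spec_map.
  apply: le_hf_inf => _ [q Dq <-]; rewrite -le_spec_map.
  by apply: hf_inf_le; exists (spec_map q).
Qed.

Definition spec_hom : es_hom (spec_space M) (spec_space L) :=
  exist _ _ spec_map_es_star_morphism.

End SpectrumMap.

Lemma spec_hom_id (L : heyting_frame) :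
  spec_hom (heytfrm_id L) = es_id (spec_space L).
Proof.
by apply: eq_exist; apply/funext => p; apply: spec_eq => x; rewrite le_spec_map.
Qed.

Lemma spec_hom_comp (L M N : heyting_frame) (g : heytfrm_hom M N)
    (f : heytfrm_hom L M) :
  spec_hom (heytfrm_comp g f) = es_comp (spec_hom f) (spec_hom g).
Proof.
apply: eq_exist; apply/funext => p; apply: spec_eq => x.
by rewrite !le_spec_map.
Qed.

Definition spec_functor : functor (op HeytFrm_star) ES_star :=
  @Functor (op HeytFrm_star) ES_star spec_space
    (fun L M f => spec_hom f) spec_hom_id
    (fun L M N g f => spec_hom_comp f g).

(** * Separation in Esakia spaces *)

Section EsakiaSpace.
Variable X : esakia_space.
Implicit Types (x y : X) (C D U : set X).

Lemma es_compact : compact [set: X].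
Proof. by have [] := es_axiom X. Qed.

Lemma es_clopen_upset x y : ~ (x <= y)%O ->
  exists U, [/\ clopen U, upset U, U x & ~ U y].
Proof. by have [_ + _] := es_axiom X; apply. Qed.

Lemma es_down_clopen U : clopen U -> clopen (down U).
Proof. by have [_ _] := es_axiom X; apply. Qed.

Lemma es_separation C x : closed C -> (forall y, C y -> ~ (x <= y)%O) ->
  exists U, [/\ clopen U, upset U, U x & forall y, C y -> ~ U y].
Proof.
move=> Ccl Cx; pose B := [set U | [/\ clopen U, upset U & U x]].
have [||U [] []|y /Cx/es_clopen_upset[U [Uc Uu Ux Uy]]|U [Uc Uu Ux] UC] :=
  compact_closed_avoid (B := B) es_compact Ccl.
- by split=> //; exact: clopenT.
- move=> U V [Uc Uu Ux] [Vc Vu Vx]; split=> //; first exact: clopenI.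
  by move=> y z yz [Uy Vy]; split; [exact: Uu Uy|exact: Vu Vy].
- by [].
- by exists U.
- by exists U.
Qed.

(** An upset that misses [C] also misses [down C], so the clopen upset separating a point from [C]
    is a neighbourhood outside [down C]. *)
Lemma es_down_closed C : closed C -> closed (down C).
Proof.
move=> Ccl; rewrite -openC openE => x ndx.
have [y Cy xy|U [[Uo _] Uu Ux UC]] := es_separation (x := x) Ccl.
  by apply: ndx; exists y.
rewrite /interior /= nbhsE; exists U; first by split.
by move=> y Uy [z /UC Uz yz]; exact: Uz (Uu _ _ yz Uy).
Qed.

Lemma down_downset D : downset (down D).
Proof. by move=> x y xy [z Dz yz]; exists z; rewrite // (le_trans xy). Qed.

Lemma subset_down D : D `<=` down D.
Proof. by move=> x Dx; exists x. Qed.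

Lemma es_hausdorff : hausdorff_space X.
Proof.
move=> x y clxy; apply/le_anti/andP; split.
  apply: contrapT => /es_clopen_upset[U [[Uo Uc] _ Ux nUy]].
  have [z []//] : U `&` ~` U !=set0.
  apply: clxy; first exact: open_nbhs_nbhs.
  by apply: open_nbhs_nbhs; split=> //; exact: closed_openC.
apply: contrapT => /es_clopen_upset[U [[Uo Uc] _ Uy nUx]].
have [z []//] : ~` U `&` U !=set0.
apply: clxy; last exact: open_nbhs_nbhs.
by apply: open_nbhs_nbhs; split=> //; exact: closed_openC.
Qed.

End EsakiaSpace.

(** * The Heyting frame of open upsets *)

Record open_upset (X : esakia_space) : Type := OpenUpset {
  upset_set :> set X;
  upset_open : open upset_set;
  upset_upset : upset upset_set }.

HB.instance Definition _ (X : esakia_space) := gen_eqMixin (open_upset X).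
HB.instance Definition _ (X : esakia_space) := gen_choiceMixin (open_upset X).

Section OpenUpsets.
Variable X : esakia_space.
Implicit Types (U V W : open_upset X) (x y : X).

Lemma upset_set_inj : injective (@upset_set X).
Proof.
case=> [U Uo Uu] [V Vo Vu] /= UV; move: Uo Uu Vo Vu; rewrite UV => *.
by congr OpenUpset; exact: Prop_irrelevance.
Qed.

Definition open_upset_le U V : bool := `[< upset_set U `<=` upset_set V >].

Lemma open_upset_le_refl : reflexive open_upset_le.
Proof. by move=> U; apply/asboolP. Qed.

Lemma open_upset_le_anti : antisymmetric open_upset_le.
Proof.
move=> U V /andP[/asboolP UV /asboolP VU].
by apply: upset_set_inj; apply/seteqP.
Qed.

Lemma open_upset_le_trans : transitive open_upset_le.
Proof.
by move=> V U W /asboolP UV /asboolP VW; apply/asboolP; exact: subset_trans VW.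
Qed.

Lemma upset0 : upset (set0 : set X). Proof. by []. Qed.

Lemma upsetT : upset [set: X]. Proof. by []. Qed.

Lemma upsetI (A B : set X) : upset A -> upset B -> upset (A `&` B).
Proof. by move=> Au Bu x y xy [Ax Bx]; split; [exact: Au Ax|exact: Bu Bx]. Qed.

Lemma upsetU (A B : set X) : upset A -> upset B -> upset (A `|` B).
Proof.
by move=> Au Bu x y xy [Ax|Bx]; [left; exact: Au Ax|right; exact: Bu Bx].
Qed.

Lemma upset_bigcup I (D : set I) (F : I -> set X) :
  (forall i, D i -> upset (F i)) -> upset (\bigcup_(i in D) F i).
Proof. by move=> Fu x y xy [i Di Fx]; exists i => //; exact: Fu Fx. Qed.

Definition open_upset0 := OpenUpset (@open0 X) upset0.
Definition open_upsetT := OpenUpset (@openT X) upsetT.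
Definition open_upsetI U V :=
  OpenUpset (openI (upset_open U) (upset_open V))
    (upsetI (@upset_upset _ U) (@upset_upset _ V)).
Definition open_upsetU U V :=
  OpenUpset (openU (upset_open U) (upset_open V))
    (upsetU (@upset_upset _ U) (@upset_upset _ V)).
Definition open_upset_bigcup (A : set (open_upset X)) :=
  OpenUpset (bigcup_open (fun U (_ : A U) => upset_open U))
    (upset_bigcup (fun U (_ : A U) => @upset_upset _ U)).

End OpenUpsets.

HB.instance Definition _ (X : esakia_space) :=
  Order.Le_isPOrder.Build (Order.Disp tt tt) (open_upset X)
    (@open_upset_le_refl X) (@open_upset_le_anti X) (@open_upset_le_trans X).

Section OpenUpsetsLattice.
Variable X : esakia_space.
Implicit Types (U V W : open_upset X).

Lemma open_upset_leP U V : reflect (upset_set U `<=` upset_set V) (U <= V)%O.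
Proof. exact: asboolP. Qed.

Lemma open_upset_le0x U : (open_upset0 X <= U)%O.
Proof. exact/open_upset_leP. Qed.

Lemma open_upset_lex1 U : (U <= open_upsetT X)%O.
Proof. exact/open_upset_leP. Qed.

Lemma open_upset_lexI U V W :
  (U <= open_upsetI V W)%O = (U <= V)%O && (U <= W)%O.
Proof.
apply/open_upset_leP/andP; rewrite subsetI.
  by move=> [UV UW]; split; apply/open_upset_leP.
by move=> [/open_upset_leP UV /open_upset_leP UW].
Qed.

Lemma open_upset_leUx U V W :
  (open_upsetU U V <= W)%O = (U <= W)%O && (V <= W)%O.
Proof.
apply/open_upset_leP/andP; rewrite subUset.
  by move=> [UW VW]; split; apply/open_upset_leP.
by move=> [/open_upset_leP UW /open_upset_leP VW].
Qed.

End OpenUpsetsLattice.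

HB.instance Definition _ (X : esakia_space) :=
  Order.POrder_MeetJoin_isLattice.Build (Order.Disp tt tt) (open_upset X)
    (@open_upset_lexI X) (@open_upset_leUx X).

HB.instance Definition _ (X : esakia_space) :=
  Order.hasBottom.Build (Order.Disp tt tt) (open_upset X) (@open_upset_le0x X).

HB.instance Definition _ (X : esakia_space) :=
  Order.hasTop.Build (Order.Disp tt tt) (open_upset X) (@open_upset_lex1 X).


Section OpenUpsetsFrame.
Variable X : esakia_space.
Implicit Types (U V W : open_upset X) (A : set (open_upset X)).

Lemma open_upset_supP A : supremums A (open_upset_bigcup A).
Proof.
split=> [U AU|V AV]; apply/open_upset_leP => x; first by exists U.
by move=> [U /AV/open_upset_leP]; apply.
Qed.

Lemma open_upset_supE A U : supremums A U -> U = open_upset_bigcup A.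
Proof. by move=> AU; apply: is_subset1_supremums AU (open_upset_supP A). Qed.

Lemma clopen_open_upset_join (r : seq (open_upset X)) :
  (forall U, U \in r -> clopen (upset_set U)) ->
  clopen (upset_set (\join_(U <- r) U)%O).
Proof.
move=> rc; rewrite big_seq; elim/big_ind: _ => //; first exact: clopen0.
by move=> U V; exact: clopenU.
Qed.

Lemma open_upset_separation U x : upset_set U x ->
  exists V, [/\ clopen (upset_set V), (V <= U)%O & upset_set V x].
Proof.
move=> Ux; have [||V [Vc Vu Vx VU]] := @es_separation X (~` upset_set U) x.
- exact: open_closedC (upset_open U).
- by move=> y Uy xy; exact: Uy (upset_upset xy Ux).
have [Vo _] := Vc; exists (OpenUpset Vo Vu); split=> //.
by apply/open_upset_leP => y /= Vy; apply: contrapT => /VU.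
Qed.

Lemma open_upset_clopen_sup U :
  supremums [set V | clopen (upset_set V) /\ (V <= U)%O] U.
Proof.
split=> [V []//|W UW]; apply/open_upset_leP => x /open_upset_separation.
by move=> [V [Vc VU Vx]]; have /open_upset_leP := UW V (conj Vc VU); apply.
Qed.

(** Every open upset is the join of the clopen upsets below it, so a compact one is a finite join of
    these. Conversely a clopen upset is topologically compact; the members of [B] are complements of
    finite joins from the cover, and one that misses [U] gives a finite subcover. *)
Lemma compact_open_upsetE :
  compact_elements (open_upset X) = [set U | clopen (upset_set U)].
Proof.
apply/seteqP; split=> U /=.
  move=> /(_ _ _ (open_upset_clopen_sup U) (lexx U)) [r rU Ur].
  rewrite (_ : U = \join_(V <- r) V)%O.
    by apply: clopen_open_upset_join => V /rU[].
  by apply/le_anti; rewrite Ur; apply/joinsP_seq => V /rU[].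
move=> [_ Uc] A s /open_upset_supE -> /open_upset_leP UA.
pose B := [set V | closed V /\ exists2 r : seq (open_upset X),
  (forall W, W \in r -> A W) & V = ~` upset_set (\join_(W <- r) W)%O].
have [||V [Vc _]//|x Ux|V [_ [r rA ->]] UV] :=
  compact_closed_avoid (B := B) (@es_compact X) Uc.
- by split; [exact: closedT|exists [::]; rewrite // big_nil setC0].
- move=> P Q [Pc [r rA PE]] [Qc [t tA QE]]; split; first exact: closedI.
  exists (r ++ t); first by move=> W; rewrite mem_cat => /orP[/rA|/tA].
  by rewrite PE QE big_cat /= setCU.
- have [V AV Vx] := UA x Ux; exists (~` upset_set V); last by apply.
  split; first exact: open_closedC (upset_open V).
  by exists [:: V]; [move=> W; rewrite inE => /eqP ->|rewrite big_seq1].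
by exists r => //; apply/open_upset_leP => x /UV/contrapT.
Qed.

Lemma open_upset_is_heyting_frame : is_heyting_frame (open_upset X).
Proof.
split.
- split=> [A|U A s /open_upset_supE ->].
    by exists (open_upset_bigcup A); exact: open_upset_supP.
  split=> [_ [V AV <-]|W UAW]; apply/open_upset_leP => x [Ux].
    by move=> Vx; split=> //; exists V.
  move=> [V AV Vx]; have /open_upset_leP := UAW _ (imageP _ AV).
  by apply.
- by rewrite compact_open_upsetE; exact: open_upset_clopen_sup.
rewrite compact_open_upsetE; split=> [|U V|U V|U V W Uc Vc].
- by split; [exact: clopen0|exact: clopenT].
- exact: clopenI.
- exact: clopenU.
(* The implication is the complement of [D], and [D] is clopen by the Esakia condition on downsets
   of clopen sets. *)
move=> [UVW WUV]; pose D := down (upset_set U `\` upset_set V).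
have /es_down_clopen Dc : clopen (upset_set U `\` upset_set V).
  by rewrite setDE; apply: clopenI => //; exact: (clopenC set0).
have [Do Dcl] : clopen (~` D) by exact: (clopenC set0).
have Du : upset (~` D).
  by move=> x y xy nDx Dy; apply: nDx; exact: down_downset Dy.
pose Z := OpenUpset Do Du.
have -> : W = Z; last by [].
apply/le_anti/andP; split.
  apply: WUV => Y /open_upset_leP UYV; apply/open_upset_leP => x Yx.
  move=> [y [Uy nVy] xy]; apply: nVy; apply: UYV; split=> //.
  exact: upset_upset Yx.
apply: UVW; apply/open_upset_leP => x [Ux nDx].
by apply: contrapT => nVx; apply: nDx; exists x.
Qed.

(* The right-hand side is the largest open upset inside all members of [A]. *)
Lemma open_upset_infP A W :
  infimums A W <->
  upset_set W = ~` down (closure (\bigcup_(U in A) ~` upset_set U)).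
Proof.
set C := closure _.
have AC U : A U -> ~` upset_set U `<=` C.
  by move=> AU x nUx; apply: subset_closure; exists U.
have infW V : upset_set V = ~` down C -> infimums A V.
  move=> VE; split=> [U AU|U UA]; apply/open_upset_leP => x; rewrite VE.
    move=> ndx; apply: contrapT => /(AC _ AU) Cx.
    by apply: ndx; exact: subset_down.
  (* Here [U] is a neighbourhood of a point of [C], so it meets the complement of some member of
     [A], although it lies inside that member. *)
  move=> Ux [y Cy xy]; have Uy := upset_upset xy Ux.
  have [z [[V' AV' nV'z] Uz]] := Cy _ (open_nbhs_nbhs (conj (upset_open U) Uy)).
  by have /open_upset_leP/(_ _ Uz) := UA _ AV'.
split=> [AW|]; last exact: infW.
have Do : open (~` down C).
  by apply: closed_openC; apply: es_down_closed; exact: closed_closure.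
have Du : upset (~` down C).
  by move=> x y xy nDx Dy; apply: nDx; exact: down_downset Dy.
have := is_subset1_infimums AW (infW (OpenUpset Do Du) erefl).
by move=> ->.
Qed.

End OpenUpsetsFrame.

Definition open_upset_frame (X : esakia_space) : heyting_frame :=
  HeytingFrame (open_upset_is_heyting_frame X).

(** * Inverse image as a morphism of frames *)

Section OpenUpsetsMap.
Variables (X Y : esakia_space) (g : es_hom X Y).

Let g_cont : continuous (sval g). Proof. by have [] := svalP g. Qed.
Let g_homo : {homo sval g : x y / (x <= y)%O}.
Proof. by have [] := svalP g. Qed.

Lemma open_preimage (U : open_upset Y) : open (sval g @^-1` upset_set U).
Proof. by move/continuousP: g_cont; apply; exact: upset_open. Qed.

Lemma upset_preimage (U : open_upset Y) : upset (sval g @^-1` upset_set U).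
Proof. by move=> x y /g_homo; exact: upset_upset. Qed.

Definition open_upset_preimage (U : open_upset Y) : open_upset X :=
  OpenUpset (@open_preimage U) (@upset_preimage U).

Lemma open_upset_preimage_morphism :
  is_heytfrm_star_morphism open_upset_preimage.
Proof.
split=> [A s /open_upset_supE ->|A s As|U].
- suff -> : open_upset_preimage (open_upset_bigcup A) =
      open_upset_bigcup (open_upset_preimage @` A) by exact: open_upset_supP.
  apply: upset_set_inj; apply/seteqP; split=> x /=.
    by move=> [U AU Ux]; exists (open_upset_preimage U) => //; exists U.
  by move=> [_ [U AU <-] Ux]; exists U.
- apply/open_upset_infP; move/open_upset_infP: As => /= ->.
  (* The side condition holds because a union of complements of upsets is a downset. *)
  have [_ _ gdown] := svalP g; rewrite -preimage_setC gdown; last first.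
    move=> x y xy [U AU nUy]; exists U => // Ux.
    by apply: nUy; exact: upset_upset Ux.
  congr (~` down (closure _)); apply/seteqP; split=> x.
    by move=> [U AU nUx]; exists (open_upset_preimage U) => //; exists U.
  by move=> [_ [U AU <-] nUx]; exists U.
- rewrite !compact_open_upsetE => Uc; exact: preimage_clopen.
Qed.

Definition open_upset_hom :
    heytfrm_hom (open_upset_frame Y) (open_upset_frame X) :=
  exist _ _ open_upset_preimage_morphism.

End OpenUpsetsMap.

Lemma open_upset_hom_id (X : esakia_space) :
  open_upset_hom (es_id X) = heytfrm_id (open_upset_frame X).
Proof. by apply: eq_exist; apply/funext => U; exact: upset_set_inj. Qed.

Lemma open_upset_hom_comp (X Y Z : esakia_space) (g : es_hom Y Z)
    (f : es_hom X Y) :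
  open_upset_hom (es_comp g f) =
  heytfrm_comp (open_upset_hom f) (open_upset_hom g).
Proof. by apply: eq_exist; apply/funext => U; exact: upset_set_inj. Qed.

Definition open_upset_functor : functor ES_star (op HeytFrm_star) :=
  @Functor ES_star (op HeytFrm_star) open_upset_frame
    (fun X Y f => open_upset_hom f) open_upset_hom_id
    (fun X Y Z g f => open_upset_hom_comp g f).

(** * Order isomorphisms and the unit *)

Section OrderIsomorphism.
Variables (L M : heyting_frame) (f : L -> M) (g : M -> L).
Hypotheses (gK : cancel g f) (f_mono : {mono f : x y / (x <= y)%O}).

Lemma order_iso_sup A s : supremums A s -> supremums (f @` A) (f s).
Proof.
move=> [As sA]; split=> [_ [x Ax <-]|y fAy]; first by rewrite f_mono; exact: As.
rewrite -(gK y) f_mono; apply: sA => x Ax.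
by rewrite -f_mono gK; apply: fAy; exists x.
Qed.

Lemma order_iso_inf A s : infimums A s -> infimums (f @` A) (f s).
Proof.
move=> [As sA]; split=> [_ [x Ax <-]|y fAy]; first by rewrite f_mono; exact: As.
rewrite -(gK y) f_mono; apply: sA => x Ax.
by rewrite -f_mono gK; apply: fAy; exists x.
Qed.

End OrderIsomorphism.

(** All three conditions depend on the order alone. For compactness of [f k], a cover is carried
    back along [g] and its finite subcover forward along [f]. *)
Lemma order_iso_heytfrm_star_morphism (L M : heyting_frame) (f : L -> M)
    (g : M -> L) : cancel f g -> cancel g f -> {mono f : x y / (x <= y)%O} ->
  is_heytfrm_star_morphism f.
Proof.
move=> fK gK fm; have gm := can_mono gK fm.
split=> [A s|A s|k Kk A s As ks].
- exact: order_iso_sup.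
- exact: order_iso_inf.
have [||r rA kr] := Kk (g @` A) (g s); first exact: order_iso_sup As.
  by rewrite -fm gK.
exists [seq f x | x <- r].
  by move=> _ /mapP[x /rA[y Ay <-] ->]; rewrite gK.
rewrite -gm fK (le_trans kr)//; apply/joinsP_seq => x xr _.
by rewrite -fm gK; apply: joins_sup_seq => //; exact: map_f.
Qed.

Section SpecUnit.
Variable L : heyting_frame.

Definition spec_unit_fun (a : L) : open_upset_frame (spec_space L) :=
  OpenUpset (@spec_open_open L a : @open (spec_space L) _)
    (@spec_open_upset L a : @upset _ (spec_space L) _).

Definition spec_unit_inv (U : open_upset_frame (spec_space L)) : L :=
  xget \bot%O [set a | spec_unit_fun a = U].

Lemma spec_unit_mono : {mono spec_unit_fun : x y / (x <= y)%O}.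
Proof.
move=> x y; apply/open_upset_leP/idP => [/spec_le_sub//|xy p /= xp yp].
exact: xp (le_trans xy yp).
Qed.

Lemma spec_unit_invK : cancel spec_unit_inv spec_unit_fun.
Proof.
move=> U; rewrite /spec_unit_inv; case: xgetP => // nU.
have [a aU] := open_upset_spec (upset_open U) (@upset_upset _ U).
by case: (nU a); apply: upset_set_inj.
Qed.

Lemma spec_unitK : cancel spec_unit_fun spec_unit_inv.
Proof.
move=> a; apply/le_anti; rewrite -[X in X && _]spec_unit_mono.
by rewrite -[X in _ && X]spec_unit_mono spec_unit_invK lexx.
Qed.

Definition spec_unit : heytfrm_hom L (open_upset_frame (spec_space L)) :=
  exist _ _
    (order_iso_heytfrm_star_morphism spec_unitK spec_unit_invK spec_unit_mono).

Definition spec_unit_back : heytfrm_hom (open_upset_frame (spec_space L)) L :=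
  exist _ _
    (order_iso_heytfrm_star_morphism spec_unit_invK spec_unitK
       (can_mono spec_unit_invK spec_unit_mono)).

End SpecUnit.

(** Arrows are reversed in the opposite category, so [spec_unit] itself goes from the double dual to
    the identity functor. *)
Lemma spec_unit_natural :
  naturally_isomorphic (functor_comp open_upset_functor spec_functor)
    (functor_id (op HeytFrm_star)).
Proof.
exists (fun L : op HeytFrm_star => spec_unit L); split.
  move=> M L f; apply: eq_exist; apply/funext => x /=.
  by apply: upset_set_inj; rewrite /= spec_map_preimage.
move=> L; exists (spec_unit_back L); split; apply: eq_exist; apply/funext => x.
  exact: spec_unit_invK.
exact: spec_unitK.
Qed.

(** * Isomorphisms of Esakia spaces and the counit *)

Section EsakiaIsomorphism.
Variables (X Y : esakia_space) (f : X -> Y) (g : Y -> X).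
Hypotheses (fK : cancel f g) (gK : cancel g f) (fc : continuous f).
Hypothesis f_mono : {mono f : x y / (x <= y)%O}.

(** A continuous bijection from a compact space to a Hausdorff space is closed. *)
Lemma es_iso_inv_continuous : continuous g.
Proof.
apply/continuous_closedP => C Ccl.
have -> : g @^-1` C = f @` C.
  apply/seteqP; split=> y; first by move=> Cy; exists (g y).
  by move=> [x Cx <-] /=; rewrite fK.
apply: compact_closed; first exact: es_hausdorff.
apply: continuous_compact; first exact/continuous_subspaceT.
by apply: subclosed_compact Ccl (@es_compact X) _.
Qed.

Lemma es_iso_down (D : set Y) : f @^-1` down D = down (f @^-1` D).
Proof.
apply/seteqP; split=> x [y Dy xy].
  by exists (g y); rewrite /= ?gK// -f_mono gK.
by exists (f y); rewrite ?f_mono.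
Qed.

End EsakiaIsomorphism.

Lemma es_iso_closure (X Y : esakia_space) (f : X -> Y) (g : Y -> X)
    (D : set Y) :
  cancel f g -> cancel g f -> continuous f -> continuous g ->
  f @^-1` closure D = closure (f @^-1` D).
Proof.
move=> fK gK fc gc; apply/seteqP; split=> x.
  move=> Dfx U Ux; have [y [Dy Uy]] : D `&` (g @^-1` U) !=set0.
    by apply: Dfx; apply: gc; rewrite fK.
  by exists (g y); split; rewrite //= gK.
move=> clx U /fc fU; have [y [Dy Uy]] := clx _ fU.
by exists (f y).
Qed.

Lemma es_iso_es_star_morphism (X Y : esakia_space) (f : X -> Y) (g : Y -> X) :
  cancel f g -> cancel g f -> continuous f -> continuous g ->
  {mono f : x y / (x <= y)%O} -> is_es_star_morphism f.
Proof.
move=> fK gK fc gc fm; split=> // [x y|D _]; first by rewrite fm.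
by rewrite (es_iso_down gK fm) (es_iso_closure D fK gK fc gc).
Qed.

Section SpecCounit.
Variable X : esakia_space.
Local Notation SX := (spec_space (open_upset_frame X)).
Implicit Types (x y : X) (U : open_upset X) (P : SX).

Lemma down1_compl_open x : open (~` down [set x]).
Proof.
apply: closed_openC; apply: es_down_closed.
by apply: compact_closed; [exact: es_hausdorff|exact: compact_set1].
Qed.

Lemma down_compl_upset (D : set X) : upset (~` down D).
Proof. by move=> x y xy nDx Dy; apply: nDx; exact: down_downset Dy. Qed.

Definition down1_compl x : open_upset_frame X :=
  OpenUpset (down1_compl_open x) (@down_compl_upset [set x]).

(** An upset meeting the principal downset of [x] contains [x]. Thus [down1_compl x] is the largest
    open upset omitting [x], from which its primality is immediate. *)
Lemma le_down1_compl U x : (U <= down1_compl x)%O <-> ~ upset_set U x.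
Proof.
split=> [/open_upset_leP Ux /Ux|nUx]; first by apply; exists x.
apply/open_upset_leP => y Uy [_ -> yx]; apply: nUx; exact: upset_upset Uy.
Qed.

Lemma down1_compl_prime x : meet_prime (down1_compl x).
Proof.
split=> [/le_down1_compl|U V /le_down1_compl UVx]; first by apply.
have [Ux|nUx] := pselect (upset_set U x); last by left; exact/le_down1_compl.
by right; apply/le_down1_compl => Vx; exact: UVx.
Qed.

Definition spec_counit_fun x : SX := Spec (down1_compl_prime x).

Lemma spec_counit_mono : {mono spec_counit_fun : x y / (x <= y)%O}.
Proof.
move=> x y; rewrite spec_leE /=; apply/idP/idP => [/le_down1_compl yx|xy].
  by have /contrapT[_ ->] := yx.
by apply/le_down1_compl; apply; exists y.
Qed.

(** The point [x] is taken outside [P] and inside every clopen upset not contained in [P]; by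
    primality these upsets are stable under intersection, so compactness provides [x]. A point [y]
    outside both [P] and the downset of [x] would have a clopen upset neighbourhood omitting [x],
    yet not contained in [P]. *)
Lemma spec_counit_surj P : exists x, spec_counit_fun x = P.
Proof.
pose B := [set V | exists U,
  [/\ V = upset_set U, clopen V & ~ (U <= spec_val P)%O]].
have Pcl : closed (~` upset_set (spec_val P)).
  exact: open_closedC (upset_open (spec_val P)).
have [x [nPx Bx]] :
    exists x, ~ upset_set (spec_val P) x /\ forall V, B V -> V x.
  apply: contrapT => nex.
  have [||V [U [_ []]]//|x nPx|_ [U [-> _ nUP]] PU] :=
    compact_closed_avoid (B := B) (@es_compact X) Pcl.
  - by exists \top%O; split=> //; [exact: clopenT|exact: (@spec_top _ P)].
  - move=> _ _ [U [-> Uc UP]] [V [-> Vc VP]]; exists (U `&` V)%O.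
    by split=> //; [exact: clopenI|move=> /(@spec_meet _ P)[]].
  - apply: contrapT => nBx; apply: nex; exists x; split=> // V BV.
    by apply: contrapT => nVx; apply: nBx; exists V.
  by apply: nUP; apply/open_upset_leP => x Ux; apply: contrapT => /PU.
exists x; apply: spec_val_inj; apply/le_anti/andP; split; last first.
  exact/le_down1_compl.
apply/open_upset_leP => y ndyx; apply: contrapT => nPy.
have [yx|U [[Uo Uc] Uu Uy nUx]] := @es_clopen_upset X y x.
  by apply: ndyx; exists x.
apply: nUx; apply: Bx; exists (OpenUpset Uo Uu); split=> //.
by move=> /open_upset_leP/(_ _ Uy).
Qed.

Definition spec_counit_inv P : X := sval (cid (spec_counit_surj P)).

Lemma spec_counit_invK : cancel spec_counit_inv spec_counit_fun.
Proof. by move=> P; exact: svalP (cid (spec_counit_surj P)). Qed.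

Lemma spec_counitK : cancel spec_counit_fun spec_counit_inv.
Proof.
by move=> x; apply/le_anti; rewrite -!spec_counit_mono spec_counit_invK lexx.
Qed.

(** The basic set of [U] and [V] pulls back to the difference of [U] and [V], which is open because
    a compact [V] is clopen. *)
Lemma spec_counit_continuous : continuous spec_counit_fun.
Proof.
apply/continuousP => W; rewrite spec_openE => Wo.
rewrite openE => x /Wo[U [V [UK VK [/= Ux Vx] UVW]]].
rewrite /interior /= nbhsE; exists (upset_set U `&` ~` upset_set V).
  split; last first.
    by split; [apply: contrapT => /le_down1_compl|apply/le_down1_compl].
  apply: openI; first exact: upset_open.
  by move: VK; rewrite compact_open_upsetE => -[_ /closed_openC].
move=> y [Uy Vy]; apply: UVW; split; last exact/le_down1_compl.
by move=> /le_down1_compl.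
Qed.

Lemma spec_counit_inv_continuous : continuous spec_counit_inv.
Proof.
exact: es_iso_inv_continuous spec_counitK spec_counit_invK
  spec_counit_continuous.
Qed.

Definition spec_counit : es_hom X SX :=
  exist _ _ (es_iso_es_star_morphism spec_counitK spec_counit_invK
    spec_counit_continuous spec_counit_inv_continuous spec_counit_mono).

Definition spec_counit_back : es_hom SX X :=
  exist _ _ (es_iso_es_star_morphism spec_counit_invK spec_counitK
    spec_counit_inv_continuous spec_counit_continuous
    (can_mono spec_counit_invK spec_counit_mono)).

End SpecCounit.

(** No reversal occurs here, so the transformation consists of the inverses [spec_counit_back].
    Naturality is checked after applying the counit of [Y]: an open upset [U] omits the image of a
    point under [g] exactly when its inverse image omits that point. *)
Lemma spec_counit_natural :
  naturally_isomorphic (functor_comp spec_functor open_upset_functor)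
    (functor_id ES_star).
Proof.
exists spec_counit_back; split; last first.
  move=> X; exists (spec_counit X); split; apply: eq_exist; apply/funext => x.
    exact: spec_counit_invK.
  exact: spec_counitK.
move=> X Y g; apply: eq_exist; apply/funext => P /=.
apply: (can_inj (@spec_counitK Y)); rewrite spec_counit_invK.
rewrite -[P in LHS]spec_counit_invK; apply: spec_eq => U.
by rewrite le_spec_map; apply/idP/idP => /le_down1_compl Ux;
  apply/le_down1_compl.
Qed.

Theorem theorem3p21 : dually_equivalent HeytFrm_star ES_star.
Proof.
by exists spec_functor, open_upset_functor; split;
  [exact: spec_unit_natural|exact: spec_counit_natural].
Qed.
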